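(* Let $D>1$ be a squarefree integer, $K=\mathbb{Q}(\sqrt{D})$, and $\mathcal{O}_K=\mathbb{Z}[\delta]$ its ring of integers, where $\delta=-\sqrt{D}$ if $D\not\equiv 1 \pmod 4$ and $\delta=\frac{1-\sqrt{D}}{2}$ if $D\equiv 1\pmod 4$. There can be at most finitely many ideals in $\mathcal{O}_K$, up to similarity of the resulting ideal lattices, whose canonical basis is stable twistable. Moreover, if the canonical basis $a,\ b+g\delta$ of some ideal $I\subseteq\mathcal{O}_K$ is stable twistable, then $$b<\begin{cases} \frac{2}{\sqrt3}\, g\sqrt{D} & \text{if } D\not\equiv 1 \pmod 4,\\ \frac{g}{2}\left(\frac{2}{\sqrt3}\sqrt{D}-1\right) & \text{if } D\equiv 1\pmod 4.\end{cases}$$ Finally, the canonical basis of $\mathcal{O}_K$ itself is stable twistable if and only if $K=\mathbb{Q}(\sqrt{5})$.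
   Context: Canonical basis: every nonzero ideal $I\subseteq\mathcal{O}_K$ can be written uniquely as $I=\{ax+(b+g\delta)y: x,y\in\mathbb{Z}\}$ with $a,b,g\in\mathbb{Z}_{\ge 0}$ satisfying $b<a$, $g\mid a$, $g\mid b$, and $ag\mid \mathbb{N}(b+g\delta)$, where $\mathbb{N}$ is the field norm; $a,\ b+g\delta$ is called the canonical basis of $I$. Let $\sigma_1,\sigma_2$ be the two real embeddings ($\sigma_1(x+y\sqrt D)=x+y\sqrt D$, $\sigma_2(x+y\sqrt D)=x-y\sqrt D$) and $\sigma_K=(\sigma_1,\sigma_2):K\to\mathbb{R}^2$. The canonical basis gives the basis matrix $B$ of the lattice $\sigma_K(I)$ with columns $\sigma_K(a)$ and $\sigma_K(b+g\delta)$. For totally positive $\alpha\in K$ let $A(\alpha)=\mathrm{diag}(\sqrt{\sigma_1(\alpha)},\sqrt{\sigma_2(\alpha)})$. For a lattice $L$ with basis matrix $C$, $\det(L)=|\det(C^{\top}C)|^{1/2}$ and $\mathrm{rk}(L)$ is the size of a basis; $L$ is stable if every sublattice $L'\subseteq L$ satisfies $\det(L)^{1/\mathrm{rk}(L)}\le \det(L')^{1/\mathrm{rk}(L')}$. A basis $v_1,v_2$ of a planar lattice is Minkowski reduced if $\|v_1\|$ is the minimal nonzero length in the lattice and $v_2$ has minimal length among vectors $x$ such that $v_1,x$ is a basis. The canonical basis is called stable twistable if there is a totally positive $\alpha\in K$ such that the columns of $A(\alpha)B$ form a Minkowski reduced basis of the stable lattice $A(\alpha)B\mathbb{Z}^2$.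 Two lattices are similar if they are related by a dilation composed with an orthogonal transformation. *)

(* Defs.v *)
From mathcomp Require Import all_boot all_order all_algebra all_field.
From mathcomp Require Import boolp classical_sets cardinality reals exp.

Set Implicit Arguments.
Unset Strict Implicit.
Unset Printing Implicit Defensive.

Import Order.TTheory GRing.Theory Num.Theory.
Local Open Scope classical_set_scope.
Local Open Scope ring_scope.

(** * Lattices in R^n *)

(* The norm that MathComp-Analysis puts on matrices is the sup norm. *)
Definition enorm (R : realType) (n : nat) (v : 'cV[R]_n) : R :=
  Num.sqrt (\sum_i v i 0 ^+ 2).

Definition int_span (R : realType) (n k : nat) (C : 'M[R]_(n, k)) :
    set 'cV[R]_n :=
  [set v | exists z : 'cV[int]_k, v = C *m map_mx intr z].

(* The first component says that the columns of [C] are independent over R. *)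
Definition lattice_basis (R : realType) (n k : nat)
    (L : set 'cV[R]_n) (C : 'M[R]_(n, k)) : Prop :=
  row_free C^T /\ L = int_span C.

(* [gram_det C] is det L for any basis matrix [C] of the lattice L. *)
Definition gram_det (R : realType) (n k : nat) (C : 'M[R]_(n, k)) : R :=
  Num.sqrt `|\det (C^T *m C)|.

(* Since rk L and det L do not depend on the basis, all bases are quantified
   over.  The zero sublattice (k' = 0) has no normalized determinant and is
   left out. *)
Definition stable (R : realType) (n : nat) (L : set 'cV[R]_n) : Prop :=
  (exists k (C : 'M[R]_(n, k)), (0 < k)%N /\ lattice_basis L C) /\
  forall k (C : 'M[R]_(n, k)), lattice_basis L C ->
  forall k' (L' : set 'cV[R]_n) (C' : 'M[R]_(n, k')),
    (0 < k')%N -> lattice_basis L' C' -> L' `<=` L ->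
    gram_det C `^ k%:R^-1 <= gram_det C' `^ k'%:R^-1.

Definition minkowski_reduced (R : realType)
    (L : set 'cV[R]_2) (v1 v2 : 'cV[R]_2) : Prop :=
  [/\ lattice_basis L (row_mx v1 v2),
      forall x, L x -> x != 0 -> enorm v1 <= enorm x &
      forall x, lattice_basis L (row_mx v1 x) -> enorm v2 <= enorm x].

Definition similar (R : realType) (n : nat) (L1 L2 : set 'cV[R]_n) : Prop :=
  exists (c : R) (U : 'M[R]_n),
    [/\ 0 < c, U^T *m U = 1%:M & L2 = [set c *: (U *m x) | x in L1]].

Definition similarity_class (R : realType) (n : nat) (L : set 'cV[R]_n) :
    set (set 'cV[R]_n) :=
  [set L' | similar L L'].

(** * Real quadratic fields *)

Definition squarefree (n : nat) : Prop :=
  forall m : nat, (m ^ 2 %| n)%N -> m = 1%N.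

(* K = Q(s) where s is a square root of D. *)
Definition generated_by_sqrt (K : fieldExtType rat) (D : nat) (s : K) : Prop :=
  s ^+ 2 = D%:R /\ <<1; s>>%VS = fullv.

Definition ring_of_integers (K : fieldExtType rat) : set K :=
  [set x | integralOver (intr : int -> K) x].

Definition is_ideal (K : fieldExtType rat) (I : set K) : Prop :=
  [/\ I `<=` @ring_of_integers K, I 0,
      forall x y, I x -> I y -> I (x + y) &
      forall r x, @ring_of_integers K r -> I x -> I (r * x)].

Definition nonzero_ideal (K : fieldExtType rat) (I : set K) : Prop :=
  is_ideal I /\ exists2 x, I x & x != 0.

(* [s] stands for the square root of D. *)
Definition delta (K : fieldExtType rat) (D : nat) (s : K) : K :=
  if (D %% 4 == 1)%N then (1 - s) / 2%:R else - s.

(* In the definitions below, [s1] and [s2] are the two real embeddings of K and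
   [d] is the generator delta of its ring of integers. *)

Definition sigmaK (R : realType) (K : fieldExtType rat) (s1 s2 : K -> R)
    (x : K) : 'cV[R]_2 :=
  \col_i (if i == 0 then s1 x else s2 x).

Definition field_norm (R : realType) (K : fieldExtType rat) (s1 s2 : K -> R)
    (x : K) : R :=
  s1 x * s2 x.

Definition canonical_basis (R : realType) (K : fieldExtType rat)
    (s1 s2 : K -> R) (d : K) (I : set K) (a b g : nat) : Prop :=
  [/\ I = [set z | exists x y : int,
             z = a%:R * x%:~R + (b%:R + g%:R * d) * y%:~R],
      (b < a)%N, (g %| a)%N, (g %| b)%N &
      exists2 N : int, field_norm s1 s2 (b%:R + g%:R * d) = N%:~R &
                       ((a * g)%N%:Z %| N)%Z].

Definition basis_matrix (R : realType) (K : fieldExtType rat)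
    (s1 s2 : K -> R) (d : K) (a b g : nat) : 'M[R]_2 :=
  row_mx (sigmaK s1 s2 a%:R) (sigmaK s1 s2 (b%:R + g%:R * d)) : 'M_(2, 1 + 1).

Definition totally_positive (R : realType) (K : fieldExtType rat)
    (s1 s2 : K -> R) (alpha : K) : Prop :=
  0 < s1 alpha /\ 0 < s2 alpha.

Definition twist (R : realType) (K : fieldExtType rat) (s1 s2 : K -> R)
    (alpha : K) : 'M[R]_2 :=
  diag_mx (\row_i Num.sqrt (sigmaK s1 s2 alpha i 0)).

Definition stable_twistable (R : realType) (K : fieldExtType rat)
    (s1 s2 : K -> R) (d : K) (a b g : nat) : Prop :=
  exists alpha : K, totally_positive s1 s2 alpha /\
    let M := twist s1 s2 alpha *m basis_matrix s1 s2 d a b g in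
    minkowski_reduced (int_span M) (col 0 M) (col 1 M) /\ stable (int_span M).

Definition has_stable_twistable_basis (R : realType) (K : fieldExtType rat)
    (s1 s2 : K -> R) (d : K) (I : set K) : Prop :=
  exists a b g : nat,
    canonical_basis s1 s2 d I a b g /\ stable_twistable s1 s2 d a b g.

(* Main.v *)
Require Import Defs.
From mathcomp Require Import all_boot all_order all_algebra all_field.
From mathcomp Require Import boolp classical_sets cardinality reals exp.
From mathcomp Require Import ring lra zify.

Set Implicit Arguments.
Unset Strict Implicit.
Unset Printing Implicit Defensive.

Import Order.TTheory GRing.Theory Num.Theory.
Local Open Scope classical_set_scope.
Local Open Scope ring_scope.

(** Write [p, q] for the two embeddings of the twist [alpha] and [x < y] for
    those of [b + g delta].  The twisted canonical basis is Minkowski reduced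
    and spans a stable lattice exactly when
    [2 a |p x + q y| <= a^2 (p + q) <= p x^2 + q y^2] and
    [p q (y - x)^2 <= a^2 (p + q)^2].  By the identity
    [(p + q) (p x^2 + q y^2) = (p x + q y)^2 + p q (y - x)^2] and AM-GM, the
    first two force [3 a^2 <= (y - x)^2 = g^2 disc K].  As [b <= a - g], this
    bounds [b]; it also leaves finitely many pairs [(a / g, b / g)], which
    determine the lattice up to dilation.  For the ring of integers, where
    [(a, b, g) = (1, 0, 1)], the first and third conditions force [D = 5], and
    for [D = 5] the twist by [(5 + s) / 10] gives an orthonormal basis. *)

(** * Lattice bases, integer spans and Gram determinants *)

Lemma lattice_basis_mulmx (R : realType) (n k : nat) (L : set 'cV[R]_n)
    (C : 'M[R]_(n, k)) (U V : 'M[int]_k) :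
  U *m V = 1%:M -> lattice_basis L C -> lattice_basis L (C *m map_mx intr U).
Proof.
move=> UV [/row_freeP[B CB] ->]; split.
  apply/row_freeP; exists (B *m (map_mx intr V)^T).
  rewrite trmx_mul mulmxA -(mulmxA _ C^T) CB mulmx1 -trmx_mul -map_mxM.
  by rewrite (mulmx1C UV) map_mx1 trmx1.
apply/seteqP; split=> v /= [z ->].
  exists (V *m z).
  by rewrite -mulmxA -map_mxM mulmxA UV mul1mx.
by exists (U *m z); rewrite map_mxM mulmxA.
Qed.

Lemma row_mx_col2 (R : realType) (M : 'M[R]_2) :
  row_mx (col 0 M) (col 1 M) = M :> 'M_2.
Proof.
apply/matrixP=> i j; rewrite mxE; case: splitP => k jk; rewrite mxE;
  by congr (fun_of_matrix M i); apply/val_inj; rewrite /= jk ord1.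
Qed.

Lemma int_span_sub (R : realType) (n k k' : nat) (M : 'M[R]_(n, k))
    (C : 'M[R]_(n, k')) :
  int_span C `<=` int_span M -> exists Z, C = M *m map_mx intr Z.
Proof.
move=> CM.
have col_int j : exists z : 'cV[int]_k, col j C = M *m map_mx intr z.
  by apply: CM; exists (delta_mx j 0); rewrite map_delta_mx colE.
have [f fE] := choice col_int.
exists (\matrix_(i, j) f j i 0); apply/matrixP=> i j.
have /matrixP/(_ i 0) := fE j; rewrite !mxE => ->.
by apply: eq_bigr => l _; rewrite !mxE.
Qed.

Lemma col_lattice_basis (R : realType) (n k : nat) (M : 'M[R]_(n, k)) j :
  row_free M^T -> lattice_basis (int_span (col j M)) (col j M).
Proof.
move=> /row_freeP[B MB]; split=> //; apply/row_freeP.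
exists (col j B); rewrite tr_col; apply/matrixP=> i l; rewrite !ord1.
have /matrixP/(_ j j) := MB; rewrite !mxE eqxx => <-.
by apply: eq_bigr => m _; rewrite !mxE.
Qed.

Lemma sub_int_span_col (R : realType) (n k : nat) (M : 'M[R]_(n, k)) j :
  int_span (col j M) `<=` int_span M.
Proof.
move=> v [z ->]; exists (delta_mx j 0 *m z).
by rewrite map_mxM map_delta_mx mulmxA -colE.
Qed.

Lemma ler_enorm (R : realType) (n : nat) (v w : 'cV[R]_n) :
  (enorm v <= enorm w) = (\sum_i v i 0 ^+ 2 <= \sum_i w i 0 ^+ 2).
Proof. by rewrite ler_sqrt // sumr_ge0 // => i _; rewrite sqr_ge0. Qed.

Lemma gram_det_square (R : realType) (n : nat) (M : 'M[R]_n) :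
  gram_det M = `|\det M|.
Proof.
by rewrite /gram_det det_mulmx det_tr -expr2 normrX sqrtr_sqr normr_id.
Qed.

Lemma gram_det_col (R : realType) (n : nat) (v : 'cV[R]_n) :
  gram_det v = enorm v.
Proof.
rewrite /gram_det /enorm det_mx11 mxE.
under eq_bigr do rewrite mxE -expr2.
by rewrite ger0_norm // sumr_ge0 // => i _; rewrite sqr_ge0.
Qed.

(** * Gram inequalities of a reduced basis of a stable planar lattice *)

Lemma det_mx22 (R : comNzRingType) (M : 'M[R]_2) :
  \det M = M 0 0 * M 1 1 - M 0 1 * M 1 0.
Proof.
rewrite (expand_det_row _ 0) big_ord_recl big_ord1 /cofactor !det_mx11 !mxE /=.
rewrite expr0 expr1 mul1r mulN1r mulrN.
by congr (M _ _ * M _ _ - M _ _ * M _ _); apply/val_inj.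
Qed.

(** Each inequality tests one competitor: the second column against its translates by plus and minus
    the first, the first column against the second, and the whole lattice against the rank-one
    sublattice spanned by the first column. *)
Lemma reduced_stable_gram (R : realType) (M : 'M[R]_2) :
  minkowski_reduced (int_span M) (col 0 M) (col 1 M) ->
  stable (int_span M) ->
  [/\ `|2%:R * (M 0 0 * M 0 1 + M 1 0 * M 1 1)| <= M 0 0 ^+ 2 + M 1 0 ^+ 2,
      M 0 0 ^+ 2 + M 1 0 ^+ 2 <= M 0 1 ^+ 2 + M 1 1 ^+ 2 &
      `|M 0 0 * M 1 1 - M 0 1 * M 1 0| <= M 0 0 ^+ 2 + M 1 0 ^+ 2].
Proof.
move=> [basis_M min1 min2] [_ stab].
rewrite row_mx_col2 in basis_M.
have sumE (v : 'cV[R]_2) : \sum_i v i 0 ^+ 2 = v 0 0 ^+ 2 + v 1 0 ^+ 2.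
  by rewrite big_ord_recl big_ord1; congr (_ + v _ _ ^+ 2); apply/val_inj.
(* Adding [e] times the first column to the second is a unimodular column operation, with inverse
   [U (- e)], so it yields another admissible second vector. *)
have shift (e : int) : \sum_i (col 1 M) i 0 ^+ 2 <=
    \sum_i (col 1 M + e%:~R *: col 0 M) i 0 ^+ 2.
  rewrite -ler_enorm; apply: min2.
  pose U (e : int) : 'M[int]_(1 + 1) := block_mx 1%:M e%:M 0 1%:M.
  have UU : U e *m U (- e) = 1%:M.
    rewrite mulmx_block !mul1mx !mulmx0 !mulmx1 !mul0mx !addr0 !add0r.
    by rewrite -raddfD /= addNr raddf0 -scalar_mx_block.
  have := lattice_basis_mulmx UU basis_M.
  rewrite -[M in M *m _]row_mx_col2 map_block_mx mul_row_block.
  rewrite !map_mx1 !map_mx0 mulmx0 addr0 !mulmx1 map_scalar_mx mul_mx_scalar.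
  by rewrite addrC.
split.
- rewrite ler_norml; apply/andP; split.
    by have := shift 1; rewrite !sumE !mxE /=; lra.
  by have := shift (- 1); rewrite !sumE !mxE /=; lra.
- have: enorm (col 0 M) <= enorm (col 1 M).
    apply: min1.
      by exists (delta_mx 1 0); rewrite map_delta_mx colE.
    case: basis_M => /row_freeP[B MB] _; apply/eqP=> M0.
    have /matrixP/(_ 1 1) := MB; rewrite !mxE big1 => [|i _].
      by move/eqP; rewrite eq_sym oner_eq0.
    by have /matrixP/(_ i 0) := M0; rewrite !mxE => ->; rewrite mul0r.
  by rewrite ler_enorm !sumE !mxE.
(* The normalized determinants here are the square root of [|det M|] and the length of the first
   column; squaring gives the claim. *)
- have := stab 2%N M basis_M 1%N _ (col 0 M) isT
    (col_lattice_basis 0 basis_M.1) (@sub_int_span_col _ _ _ M 0).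
  rewrite gram_det_square gram_det_col invr1 powRr1 ?sqrtr_ge0 //.
  rewrite powR12_sqrt // ler_sqrt; last first.
    by rewrite sumr_ge0 // => i _; rewrite sqr_ge0.
  by rewrite det_mx22 sumE !mxE.
Qed.

(** * Lattices with an orthonormal basis *)

Lemma gram_det_gt0 (R : realType) (n k : nat) (C : 'M[R]_(n, k)) :
  row_free C^T -> 0 < gram_det C.
Proof.
move=> freeC; rewrite sqrtr_gt0 normr_gt0 -unitfE -[_ \is a _]/(_ \in unitmx).
rewrite -row_free_unit; apply: inj_row_free => v vG.
apply/(row_free_inj freeC); rewrite mul0mx; apply/trmx_inj/eqP.
rewrite trmx0 trmx_mul trmxK.
(* A vector killed by the Gram matrix [G] satisfies [|C v^T|^2 = v G v^T = 0], so independence of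
   the columns of [C] forces it to vanish. *)
have: \sum_i (C *m v^T) i 0 ^+ 2 = 0.
  have /matrixP/(_ 0 0) : (C *m v^T)^T *m (C *m v^T) = 0.
    by rewrite trmx_mul trmxK mulmxA -(mulmxA v) vG mul0mx.
  rewrite !mxE => {2}<-; apply: eq_bigr => i _.
  by rewrite [in RHS]mxE expr2.
move/psumr_eq0P => H; apply/eqP/matrixP => i j.
rewrite ord1 [RHS]mxE; apply/eqP; rewrite -sqrf_eq0; apply/eqP/H => // l _.
by rewrite sqr_ge0.
Qed.

(** Writing [C = M Z] with [Z] integral turns the Gram matrix of [C] into [Z^T Z], whose determinant
    is a nonzero integer. *)
Lemma orthonormal_gram_det_ge1 (R : realType) (n m k : nat) (M : 'M[R]_(n, m))
    (C : 'M[R]_(n, k)) :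
  M^T *m M = 1%:M -> row_free C^T -> int_span C `<=` int_span M ->
  1 <= gram_det C.
Proof.
move=> orthM /gram_det_gt0 + /int_span_sub[Z CE].
rewrite /gram_det CE trmx_mul mulmxA -(mulmxA _ M^T) orthM mulmx1.
rewrite matrix.map_trmx -map_mxM det_map_mx sqrtr_gt0 -intr_norm ltr0z => Z_gt0.
by rewrite -[X in X <= _]sqrtr1 ler_sqrt ?ler1z ?ler0z // gtz0_ge1.
Qed.

Lemma orthonormal_gram_det_basis (R : realType) (n m k : nat)
    (M : 'M[R]_(n, m)) (C : 'M[R]_(n, k)) :
  M^T *m M = 1%:M -> lattice_basis (int_span M) C -> gram_det C = 1.
Proof.
move=> orthM [freeC MC].
have [Z CE] : exists Z, C = M *m map_mx intr Z by apply: int_span_sub; rewrite MC.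
have [W ME] : exists W, M = C *m map_mx intr W by apply: int_span_sub; rewrite MC.
have intr_inj_mx p q : injective (map_mx intr : 'M[int]_(p, q) -> 'M[R]_(p, q)).
  move=> A B /matrixP AB; apply/matrixP=> i j.
  by have := AB i j; rewrite !mxE; apply: intr_inj.
have WZ : W *m Z = 1%:M.
  apply: intr_inj_mx; rewrite map_mx1 map_mxM.
  apply: trmx_inj; apply: (row_free_inj freeC).
  by rewrite -!trmx_mul mulmx1 mulmxA -ME -CE.
have ZW : Z *m W = 1%:M.
  apply: intr_inj_mx; rewrite map_mx1 map_mxM.
  by rewrite -[LHS]mul1mx -orthM -mulmxA (mulmxA M) -CE -ME.
rewrite /gram_det CE trmx_mul mulmxA -(mulmxA _ M^T) orthM mulmx1.
rewrite matrix.map_trmx -map_mxM det_map_mx -intr_norm.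
(* [Z] and [W] are a priori rectangular, so determinants are taken of the square integer matrices
   [Z^T Z] and [W W^T], which are inverse to each other. *)
have /(congr1 absz) : \det (Z^T *m Z) * \det (W *m W^T) = 1.
  by rewrite -det_mulmx mulmxA -(mulmxA _ Z) ZW mulmx1 -trmx_mul WZ trmx1 det1.
rewrite abszM => /eqP; rewrite muln_eq1 => /andP[/eqP Z1 _].
by rewrite -abszE Z1 sqrtr1.
Qed.

Lemma orthonormal_enorm_col (R : realType) (n m : nat) (M : 'M[R]_(n, m)) j :
  M^T *m M = 1%:M -> enorm (col j M) = 1.
Proof.
move=> /matrixP/(_ j j); rewrite !mxE eqxx => Mjj.
rewrite -[RHS]sqrtr1 -[1]Mjj; congr Num.sqrt.
by apply: eq_bigr => i _; rewrite !mxE expr2.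
Qed.

(** Lengths are rank-one Gram determinants, so both reducedness and stability compare the value 1,
    attained by the columns and by the whole lattice, with Gram determinants that are at least 1. *)
Lemma orthonormal_reduced_stable (R : realType) (M : 'M[R]_2) :
  M^T *m M = 1%:M ->
  minkowski_reduced (int_span M) (col 0 M) (col 1 M) /\ stable (int_span M).
Proof.
move=> orthM; have freeM : row_free M^T by apply/row_freeP; exists M.
split.
  split; first by rewrite row_mx_col2.
    move=> x Mx x0; rewrite orthonormal_enorm_col // -gram_det_col.
    apply: (orthonormal_gram_det_ge1 orthM).
      by rewrite /row_free rank_rV -[0]trmx0 (inj_eq trmx_inj) x0.
    case: Mx => z -> _ [y ->]; exists (z *m y).
    by rewrite map_mxM mulmxA.
  move=> x [freex Mx]; rewrite orthonormal_enorm_col // -gram_det_col.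
  have xE : x = col (rshift 1 0) (row_mx (col 0 M) x).
    by rewrite colKr; apply/matrixP=> i j; rewrite mxE ord1.
  have basis_x := @col_lattice_basis R 2 (1 + 1) _ (rshift 1 0) freex.
  rewrite xE; apply: (orthonormal_gram_det_ge1 orthM); first exact: basis_x.1.
  by rewrite Mx; apply: sub_int_span_col.
split; first by exists 2%N, M.
move=> k C /(orthonormal_gram_det_basis orthM) -> k' L' C' _ [freeC' ->] sub.
have C'1 := orthonormal_gram_det_ge1 orthM freeC' sub.
have : 1 `^ k'%:R^-1 <= gram_det C' `^ k'%:R^-1.
  by rewrite ge0_ler_powR ?invr_ge0 ?ler0n // nnegrE (le_trans ler01).
by rewrite !powR1.
Qed.

(** * Inequalities satisfied by a stable twistable canonical basis *)

Lemma twisted_basis (R : realType) (K : fieldExtType rat) (s1 s2 : K -> R)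
    (alpha d : K) (a b g : nat) (M : 'M[R]_2) :
  M = twist s1 s2 alpha *m basis_matrix s1 s2 d a b g ->
  [/\ M 0 0 = Num.sqrt (s1 alpha) * s1 a%:R,
      M 1 0 = Num.sqrt (s2 alpha) * s2 a%:R,
      M 0 1 = Num.sqrt (s1 alpha) * s1 (b%:R + g%:R * d) &
      M 1 1 = Num.sqrt (s2 alpha) * s2 (b%:R + g%:R * d)].
Proof.
rewrite /twist mul_diag_mx => ->.
by split; rewrite !mxE /=; congr (_ * _); case: splitP => k //=;
  rewrite ?ord1 // => _; rewrite mxE.
Qed.

Lemma stable_twistable_gram (R : realType) (K : fieldExtType rat)
    (s1 s2 : {rmorphism K -> R}) (d : K) (a b g : nat) :
  stable_twistable s1 s2 d a b g ->
  exists p q : R, let x := b%:R + g%:R * s1 d in let y := b%:R + g%:R * s2 d in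
    [/\ 0 < p, 0 < q,
        `|2 * a%:R * (p * x + q * y)| <= a%:R ^+ 2 * (p + q),
        a%:R ^+ 2 * (p + q) <= p * x ^+ 2 + q * y ^+ 2 &
        p * q * (a%:R * (y - x)) ^+ 2 <= (a%:R ^+ 2 * (p + q)) ^+ 2].
Proof.
move=> [alpha [[p_gt0 q_gt0] /=]].
set M : 'M[R]_2 := _ *m _; case=> red stab.
have [gram1 gram2 gram3] := reduced_stable_gram red stab.
have [M00 M10 M01 M11] := twisted_basis (erefl M).
rewrite M00 M10 M01 M11 !rmorphD !rmorphM !rmorph_nat /= in gram1 gram2 gram3.
exists (s1 alpha), (s2 alpha) => /=; move: gram1 gram2 gram3.
move: (s1 alpha) (s2 alpha) p_gt0 q_gt0 => p q p_gt0 q_gt0.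
set x := b%:R + g%:R * s1 d; set y := b%:R + g%:R * s2 d.
have p2 := sqr_sqrtr (ltW p_gt0); have q2 := sqr_sqrtr (ltW q_gt0).
set P := Num.sqrt p in p2 *; set Q := Num.sqrt q in q2 *.
rewrite -p2 -q2 => gram1 gram2 gram3; split.
- by rewrite p2.
- by rewrite q2.
- apply: le_trans (le_trans gram1 _); last lra.
  by rewrite le_eqVlt; apply/orP; left; apply/eqP; congr `|_|; ring.
- lra.
(* Squaring the determinant inequality removes the square roots [P] and [Q], leaving a condition on
   [p] and [q] alone. *)
- have -> : P ^+ 2 * Q ^+ 2 * (a%:R * (y - x)) ^+ 2 =
            `|P * a%:R * (Q * y) - P * x * (Q * a%:R)| ^+ 2.
    by rewrite real_normK ?num_real //; ring.
  rewrite ler_pXn2r ?nnegrE ?normr_ge0 //; first lra.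
  by rewrite mulr_ge0 ?addr_ge0 ?sqr_ge0.
Qed.

(** With [m = p x + q y] and [S = p + q], the hypotheses give [4 m^2 <= a^2 S^2] and
    [a^2 S^2 <= m^2 + p q (y - x)^2]. Hence [3 a^2 S^2 <= 4 p q (y - x)^2], and [4 p q <= S^2]. *)
Lemma reduced_form_bound (R : realFieldType) (a p q x y : R) :
  0 < a -> 0 < p -> 0 < q ->
  `|2 * a * (p * x + q * y)| <= a ^+ 2 * (p + q) ->
  a ^+ 2 * (p + q) <= p * x ^+ 2 + q * y ^+ 2 ->
  3 * a ^+ 2 <= (y - x) ^+ 2.
Proof.
move=> a_gt0 p_gt0 q_gt0; set m := p * x + q * y.
have -> : 2 * a * m = a * (2 * m) by ring.
have -> : a ^+ 2 * (p + q) = a * (a * (p + q)) by ring.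
rewrite normrM gtr0_norm // ler_pM2l // => m_le le_mean.
have S_gt0 : 0 < p + q by apply: addr_gt0.
have m2_le : 4 * m ^+ 2 <= (a * (p + q)) ^+ 2.
  have -> : 4 * m ^+ 2 = `|2 * m| ^+ 2 by rewrite real_normK ?num_real //; ring.
  by rewrite ler_pXn2r ?nnegrE ?normr_ge0 // mulr_ge0 ?ltW.
have mean_eq : (p + q) * (p * x ^+ 2 + q * y ^+ 2) =
               m ^+ 2 + p * q * (y - x) ^+ 2 by rewrite /m; ring.
have : (p + q) * (a * (a * (p + q))) <= (p + q) * (p * x ^+ 2 + q * y ^+ 2).
  by rewrite ler_pM2l //; lra.
rewrite mean_eq => le_pq.
have pq_le : 4 * (p * q * (y - x) ^+ 2) <= (p + q) ^+ 2 * (y - x) ^+ 2.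
  by have := sqr_ge0 ((p - q) * (y - x)); lra.
rewrite -(ler_pM2l (exprn_gt0 2 S_gt0)); lra.
Qed.

(** Since [2 (p x + q y) = (p + q) (x + y) - (p - q) (y - x)], the first inequality bounds
    [(p - q) (y - x)]; the second bounds [p q (y - x)^2]. They combine through
    [(p + q)^2 = (p - q)^2 + 4 p q]. *)
Lemma stable_form_bound (R : realFieldType) (p q x y : R) :
  0 < p -> 0 < q -> 0 <= x + y ->
  `|2 * (p * x + q * y)| <= p + q -> p * q * (y - x) ^+ 2 <= (p + q) ^+ 2 ->
  (y - x) ^+ 2 <= 4 + (1 + (x + y)) ^+ 2.
Proof.
move=> p_gt0 q_gt0 xy_ge0 m_le det_le.
have S_gt0 : 0 < p + q by apply: addr_gt0.
have pq_le : `|(p - q) * (y - x)| <= (p + q) * (1 + (x + y)).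
  by move: m_le; rewrite !ler_norml => /andP[? ?]; apply/andP; split; nra.
have : `|(p - q) * (y - x)| ^+ 2 <= ((p + q) * (1 + (x + y))) ^+ 2.
  by rewrite ler_pXn2r ?nnegrE ?normr_ge0 // mulr_ge0 //; lra.
rewrite real_normK ?num_real // => {}pq_le.
rewrite -(ler_pM2l (exprn_gt0 2 S_gt0)); lra.
Qed.

(** * Arithmetic of quadratic fields *)

Lemma rat_integral (F : numFieldType) (r : rat) :
  integralOver (intr : int -> F) (ratr r) -> exists n : int, r = n%:~R.
Proof.
move=> [p p_monic p_r].
have map_intr (L : numFieldType) :
    map_poly (intr : int -> L) p = map_poly ratr (map_poly (intr : int -> rat) p).
  by apply/polyP=> i; rewrite !coef_map /= ratr_int.
(* The monic integer polynomial vanishing at [r] is read in [algC], where rational algebraic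
   integers are known to be integers. *)
have : ratr r \in Aint.
  apply: (@root_monic_Aint (map_poly intr p)).
  - by move: p_r; rewrite (map_intr F) (map_intr algC) !fmorph_root.
  - exact: monic_map.
  - by apply/polyOverP=> i; rewrite coef_map /= rpred_int.
move/(Cint_rat_Aint (Crat_rat r))/intrP => [n rn]; exists n.
by apply: (fmorph_inj (ratr : {rmorphism rat -> algC})); rewrite /= rn ratr_int.
Qed.

(** Clearing denominators, the square of the denominator of [v] divides [D] times the square of its
    numerator; by coprimality it divides [D], so it is 1. *)
Lemma squarefree_sqr_int (D : nat) (v : rat) (N : int) :
  squarefree D -> v ^+ 2 * D%:R = N%:~R -> exists n : int, v = n%:~R.
Proof.
move=> sqf vN; exists (numq v).
have d_neq0 : (denq v)%:~R != 0 :> rat by rewrite intr_eq0 denq_neq0.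
have eqZ : numq v ^+ 2 * D%:Z = N * denq v ^+ 2.
  apply: (@intr_inj rat); rewrite !expr2 !rmorphM /= -vN -pmulrn.
  by rewrite -{3}[v]divq_num_den; field.
have : (`|denq v| ^ 2 %| D)%N.
  rewrite -(@Gauss_dvdr _ (`|numq v| ^ 2)); last first.
    by rewrite coprimeXl // coprimeXr // coprime_sym coprime_num_den.
  have /(congr1 absz) := eqZ; rewrite !expr2 !abszM -!mulnn => ->.
  exact: dvdn_mull.
move/sqf => d1; rewrite -[LHS]divq_num_den.
by rewrite -[denq v]gez0_abs // d1 divr1.
Qed.

Lemma quadratic_coordinates (K : fieldExtType rat) (D : nat) (s : K) :
  generated_by_sqrt D s -> forall z, exists u v : rat, z = u%:A + v%:A * s.
Proof.
move=> [s2 Ks] z; have : z \in <<1; s>>%VS by rewrite Ks memvf.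
move=> /Fadjoin1_polyP[p ->]; elim/poly_ind: p => [|p c [u [v IH]]].
  by exists 0, 0; rewrite map_poly0 horner0 scale0r mul0r addr0.
(* Horner step: [(u + v s) s + c = (v D + c) + u s]. *)
exists (v * D%:R + c), u.
rewrite rmorphD rmorphM /= map_polyX map_polyC hornerMXaddC IH /=.
have -> : (v * D%:R + c)%:A = v%:A * s ^+ 2 + c%:A :> K.
  by rewrite s2 scalerDl mulr_algl -scalerA scaler_nat.
ring.
Qed.

Lemma fmorph_alg (K : fieldExtType rat) (F : numFieldType)
    (f : {rmorphism K -> F}) (u : rat) : f u%:A = ratr u.
Proof. by rewrite alg_num_field fmorph_rat. Qed.

Lemma squarefree_sqr_eq5 (D : nat) (v : rat) :
  squarefree D -> v ^+ 2 * D%:R = 5%:R -> D = 5%N.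
Proof.
move=> sqf v5; have [n vn] := @squarefree_sqr_int D v 5 sqf v5.
have : (`|n| ^ 2 * D = 5)%N.
  have : n ^+ 2 * D%:Z = 5.
    by apply: (@intr_inj rat); rewrite expr2 !rmorphM /= -vn; exact: v5.
  by move/(congr1 absz); rewrite expr2 !abszM -mulnn.
case: `|n|%N => [|[|[|m]]]; case: (D) => [|k]; rewrite -mulnn; nia.
Qed.

(** Writing [r = u + v s], the two embeddings of [r^2 = 5] differ by [4 u v] times the square root
    of [D], so one of [u], [v] vanishes. *)
Lemma quadratic_sqrt5 (R : realType) (D : nat) (K : fieldExtType rat)
    (s r : K) (s1 s2 : {rmorphism K -> R}) :
  squarefree D -> generated_by_sqrt D s -> s1 s = Num.sqrt D%:R ->
  s2 s = - Num.sqrt D%:R -> (0 < D)%N -> r ^+ 2 = 5%:R -> D = 5%N.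
Proof.
move=> sqf genD s1s s2s D_gt0 r5.
have [u [v rE]] := quadratic_coordinates genD r.
have := congr1 s1 r5; have := congr1 s2 r5.
rewrite rE !rmorph_nat !rmorphXn !rmorphD !rmorphM !fmorph_alg s1s s2s /=.
have D0 : 0 < Num.sqrt D%:R :> R by rewrite sqrtr_gt0 ltr0n.
have D2 : Num.sqrt D%:R ^+ 2 = D%:R :> R by rewrite sqr_sqrtr ?ler0n.
set t := Num.sqrt _ in D0 D2 *; set x : R := ratr u; set y : R := ratr v.
move=> eq2 eq1.
have : x * y = 0.
  apply: (mulIf (lt0r_neq0 D0)); rewrite mul0r; lra.
move/eqP; rewrite mulf_eq0 !fmorph_eq0 => /orP[]/eqP ?; subst.
  apply: (@squarefree_sqr_eq5 D v) => //.
  apply: (fmorph_inj (ratr : {rmorphism rat -> R})).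
  rewrite rmorphM rmorphXn !rmorph_nat -D2 -eq1 /x rmorph0; ring.
(* When [v = 0], the rational [u] squares to 5; the previous lemma for the squarefree number 1 makes
   this absurd. *)
have: 1%N = 5%N; last by [].
apply: (@squarefree_sqr_eq5 1 u).
  by move=> m; rewrite dvdn1 -[1%N](exp1n 2) eqn_exp2r // => /eqP.
apply: (fmorph_inj (ratr : {rmorphism rat -> R})).
rewrite rmorphM rmorphXn !rmorph_nat -eq1 /y rmorph0; ring.
Qed.

Lemma integral_intr_rmorph (A B : nzRingType) (f : {rmorphism A -> B}) (x : A) :
  integralOver (intr : int -> A) x -> integralOver (intr : int -> B) (f x).
Proof.
move=> /(integral_rmorph f)[p p_monic p_root]; exists p => //.
by rewrite (eq_map_poly (g := f \o intr)) // => n /=; rewrite rmorph_int.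
Qed.

(** For [z = u + v s] integral, the trace [2 u = n] and the norm [u^2 - 5 v^2 = m] are integers.
    Then [5 (2 v)^2 = n^2 - 4 m] makes [2 v = k] an integer, and [n], [k] have the same parity. *)
Lemma integers_sqrt5 (R : realType) (K : fieldExtType rat) (s : K)
    (s1 s2 : {rmorphism K -> R}) :
  generated_by_sqrt 5 s -> s1 s = Num.sqrt 5%:R -> s2 s = - Num.sqrt 5%:R ->
  @ring_of_integers K =
    [set z | exists x y : int, z = x%:~R + delta 5 s * y%:~R].
Proof.
move=> gen5 s1s s2s; have nat_neq0 n : n.+1%:R != 0 :> K.
  by rewrite -(fmorph_eq0 s1) rmorph_nat pnatr_eq0.
have s5 : s ^+ 2 = 5%:R by case: gen5.
have t5 : Num.sqrt 5%:R ^+ 2 = 5%:R :> R by rewrite sqr_sqrtr ?ler0n.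
apply/seteqP; split=> [z z_int|_ [x [y ->]]] /=; last first.
  apply: (integral_add (RtoK := intr)); first exact: integral_id.
  apply: (integral_mul (RtoK := intr)); last exact: integral_id.
  (* The minimal polynomial of delta, which here is the conjugate of the golden ratio. *)
  pose p : {poly int} := 'X^2 - 'X - 1.
  exists p.
    by rewrite /p monicE lead_coefDl ?lead_coefDl ?lead_coefXn //
      ?size_polyN ?size_polyX ?size_polyXn ?size_poly1 // size_polyDl
      ?size_polyN ?size_polyX ?size_polyXn.
  rewrite /p /root !rmorphB /= map_polyXn map_polyX rmorph1 !hornerE /delta /=.
  apply/eqP; transitivity ((s ^+ 2 - 5%:R) / (2%:R * 2%:R)).
    by field; rewrite !nat_neq0.
  by rewrite s5 subrr mul0r.
have [u [v zE]] := quadratic_coordinates gen5 z.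
have int1 := integral_intr_rmorph s1 z_int.
have int2 := integral_intr_rmorph s2 z_int.
have [n nE] : exists n : int, 2%:R * u = n%:~R.
  apply: (@rat_integral R).
  have := integral_add (RtoK := intr) int1 int2.
  congr (integralOver _ _).
  rewrite zE !rmorphD !rmorphM !fmorph_alg s1s s2s rmorph_nat; ring.
have [m mE] : exists m : int, u ^+ 2 - 5%:R * v ^+ 2 = m%:~R.
  apply: (@rat_integral R).
  have := integral_mul (RtoK := intr) int1 int2.
  congr (integralOver _ _).
  rewrite rmorphB /= rmorphXn rmorphM rmorphXn rmorph_nat.
  rewrite zE !rmorphD !rmorphM !fmorph_alg /=.
  by rewrite s1s s2s -[X in _ - X * _]t5; ring.
have [k kE] : exists k : int, 2%:R * v = k%:~R.
  apply: (@squarefree_sqr_int 5 _ (n ^+ 2 - 4 * m)).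
    by case=> [|[|[|e]]] // /dvdn_leq-/(_ isT); rewrite -mulnn; nia.
  by rewrite rmorphB expr2 !rmorphM /= -nE -mE; ring.
have nkm : n ^+ 2 - 5 * k ^+ 2 = 4 * m.
  apply: (@intr_inj rat).
  by rewrite rmorphB !expr2 !rmorphM /= -nE -mE -kE; ring.
(* If [n + k] were odd, [n^2 - 5 k^2] would be odd, against its value [4 m]. The integer [x] is the
   constant coordinate of [z = x - k delta]. *)
have [x xE] : exists x, n + k = 2 * x.
  exists ((n + k) %/ 2)%Z; move: nkm (divz_eq (n + k) 2).
  have := modz_ge0 (n + k) (isT : (2 : int) != 0).
  have := ltz_pmod (n + k) (isT : (0 : int) < 2).
  set r := ((n + k) %% 2)%Z; set h := ((n + k) %/ 2)%Z => r2 r0 nkm hE.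
  have : r = 0 \/ r = 1 by lia.
  case=> rE; first by lia.
  have nh : n = 2 * h + 1 - k by lia.
  by move: nkm; rewrite nh !expr2; lia.
exists x, (- k); rewrite zE /delta /=.
have uE : u = (2%:R * x%:~R - k%:~R) / 2%:R.
  have -> : 2%:R * x%:~R = n%:~R + k%:~R :> rat.
    by rewrite -rmorphD xE rmorphM.
  by rewrite -nE; field.
have vE : v = k%:~R / 2%:R by rewrite -kE; field.
have -> : u%:A = (2%:R * x%:~R - k%:~R) / 2%:R :> K.
  rewrite uE -[LHS]/(in_alg K _) rmorphM fmorphV rmorphB rmorphM.
  by rewrite !rmorph_int !rmorph_nat.
have -> : v%:A = k%:~R / 2%:R :> K.
  by rewrite vE -[LHS]/(in_alg K _) rmorphM fmorphV !rmorph_int !rmorph_nat.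
by rewrite rmorphN; field; rewrite nat_neq0.
Qed.

(** * Canonical bases and finiteness up to similarity *)

Lemma delta_embedding (R : realType) (K : fieldExtType rat) (D : nat) (s : K)
    (f : {rmorphism K -> R}) :
  f (delta D s) = if (D %% 4 == 1)%N then (1 - f s) / 2%:R else - f s.
Proof.
rewrite /delta; case: ifP => _; last by rewrite rmorphN.
by rewrite rmorphM fmorphV rmorphB rmorph1 rmorph_nat.
Qed.

Lemma canonical_basis_gt0 (R : realType) (K : fieldExtType rat)
    (s1 s2 : K -> R) (d : K) (I : set K) (a b g : nat) :
  canonical_basis s1 s2 d I a b g -> (0 < a)%N /\ (0 < g)%N.
Proof.
move=> [_ b_lt_a g_dvd_a _ _]; have a_gt0 : (0 < a)%N by apply: leq_trans b_lt_a.
by split=> //; apply: dvdn_gt0 g_dvd_a.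
Qed.

Lemma stable_twistable_bound (R : realType) (K : fieldExtType rat)
    (s1 s2 : {rmorphism K -> R}) (d : K) (a b g : nat) :
  (0 < a)%N -> stable_twistable s1 s2 d a b g ->
  3 * a%:R ^+ 2 <= (g%:R * (s2 d - s1 d)) ^+ 2.
Proof.
move=> a_gt0 /stable_twistable_gram[p [q /= [p_gt0 q_gt0 gram1 gram2 _]]].
have := reduced_form_bound _ p_gt0 q_gt0 gram1 gram2.
rewrite ltr0n => /(_ a_gt0); congr (_ <= _ ^+ 2); ring.
Qed.

Lemma similarity_class_scale (R : realType) (n : nat) (c : R)
    (L : set 'cV[R]_n) :
  0 < c -> similarity_class [set c *: x | x in L] = similarity_class L.
Proof.
move=> c_gt0; apply/seteqP; split=> L' [k [U [k_gt0 orthU ->]]].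
  exists (k * c), U; split=> //; first exact: mulr_gt0.
  rewrite image_comp; congr image; apply/funext=> x /=.
  by rewrite -scalemxAr scalerA.
exists (k / c), U; split=> //; first exact: divr_gt0.
rewrite image_comp; congr image; apply/funext=> x /=.
by rewrite -scalemxAr scalerA divfK // gt_eqF.
Qed.

Lemma sigmaK_natmul (R : realType) (K : fieldExtType rat)
    (s1 s2 : {rmorphism K -> R}) (n : nat) (z : K) :
  sigmaK s1 s2 (n%:R * z) = n%:R *: sigmaK s1 s2 z.
Proof.
by apply/matrixP=> i j; rewrite !mxE; case: ifP => _; rewrite rmorphM rmorph_nat.
Qed.

(** The shape of a canonical basis after division by [g]. For arbitrary [a] and [b] it is only a
    Z-module, which is enough to index similarity classes by pairs of naturals. *)
Definition basis_module (K : fieldExtType rat) (d : K) (a b : nat) : set K :=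
  [set z | exists x y : int, z = a%:R * x%:~R + (b%:R + d) * y%:~R].

Lemma similarity_class_canonical (R : realType) (K : fieldExtType rat)
    (s1 s2 : {rmorphism K -> R}) (d : K) (I : set K) (a b g : nat) :
  canonical_basis s1 s2 d I a b g ->
  similarity_class [set sigmaK s1 s2 x | x in I] =
  similarity_class
    [set sigmaK s1 s2 x | x in basis_module d (a %/ g) (b %/ g)].
Proof.
move=> can; have [_ g_gt0] := canonical_basis_gt0 can.
case: can => -> _ g_dvd_a g_dvd_b _.
have g_gt0R : 0 < g%:R :> R by rewrite ltr0n.
rewrite -[RHS](similarity_class_scale _ g_gt0R) image_comp; congr similarity_class.
have scaled x y : a%:R * x%:~R + (b%:R + g%:R * d) * y%:~R =
    g%:R * ((a %/ g)%:R * x%:~R + ((b %/ g)%:R + d) * y%:~R) :> K.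
  by rewrite -{1}(divnK g_dvd_a) -{1}(divnK g_dvd_b) !natrM; ring.
apply/seteqP; split=> v [z [x [y ->]] <-] /=.
  exists ((a %/ g)%:R * x%:~R + ((b %/ g)%:R + d) * y%:~R); first by exists x, y.
  by rewrite /= scaled sigmaK_natmul.
exists (a%:R * x%:~R + (b%:R + g%:R * d) * y%:~R); first by exists x, y.
by rewrite /= scaled sigmaK_natmul.
Qed.

Lemma finite_stable_twistable_classes (R : realType) (K : fieldExtType rat)
    (s1 s2 : {rmorphism K -> R}) (d : K) :
  finite_set [set similarity_class [set sigmaK s1 s2 x | x in I] | I in
    [set I : set K | nonzero_ideal I /\ has_stable_twistable_basis s1 s2 d I]].
Proof.
have [N NE] : exists N : nat, (s2 d - s1 d) ^+ 2 <= N%:R.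
  exists (Num.bound ((s2 d - s1 d) ^+ 2)).
  by apply/ltW; rewrite archi_boundP // sqr_ge0.
pose class_of (ab : nat * nat) := similarity_class
  [set sigmaK s1 s2 x | x in basis_module d ab.1 ab.2].
apply: (@sub_finite_set _ _ (class_of @` (`I_N.+1 `*` `I_N.+1))); last first.
  by apply: finite_image; apply: finite_setX; exact: finite_II.
move=> _ [I [_ [a [b [g [can twistable]]]]] <-].
exists (a %/ g, b %/ g)%N; last by rewrite (similarity_class_canonical can).
have [a_gt0 g_gt0] := canonical_basis_gt0 can.
have := stable_twistable_bound a_gt0 twistable.
case: can => _ b_lt_a /divnK; set a' := (a %/ g)%N => aE _ _.
rewrite -aE exprMn natrM exprMn mulrA mulrC ler_pM2l ?exprn_gt0 ?ltr0n // => aN.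
(* From [3 a'^2 <= N]; then [b / g <= a / g] puts both quotients among the naturals up to [N]. *)
have {}aN : (a' <= N)%N.
  have := le_trans aN NE; rewrite -natrX -natrM ler_nat; nia.
split=> /=; rewrite ltnS //.
by apply: leq_trans aN; exact/leq_div2r/ltnW.
Qed.

(** * The canonical basis of the ring of integers *)

Lemma ring_of_integers_canonical (R : realType) (K : fieldExtType rat)
    (s1 s2 : {rmorphism K -> R}) (d : K) (a b g : nat) :
  s1 d != s2 d -> canonical_basis s1 s2 d (@ring_of_integers K) a b g ->
  [/\ a = 1%N, b = 0%N & g = 1%N].
Proof.
move=> d_neq can; have [a_gt0 g_gt0] := canonical_basis_gt0 can.
case: can => OK_eq b_lt_a g_dvd_a _ _.
have : @ring_of_integers K 1 by exact: (integral1 (intr : {rmorphism int -> K})).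
rewrite OK_eq => -[x [y one_eq]].
(* The two embeddings agree on 1 but separate [d], so 1 has no component along the second basis
   vector; then [a] divides 1, and [b] and [g] follow. *)
have y0 : y = 0.
  have := congr1 s1 one_eq; have := congr1 s2 one_eq.
  rewrite !rmorph1 !rmorphD !rmorphM !rmorphD !rmorphM !rmorph_nat !rmorph_int.
  move=> eq2 eq1; have : g%:R * (s1 d - s2 d) * y%:~R = 0 by lra.
  move/eqP; rewrite !mulf_eq0 subr_eq0 (negPf d_neq) pnatr_eq0 eqn0Ngt g_gt0 /=.
  by rewrite intr_eq0 => /eqP.
have a1 : a = 1%N.
  have /(congr1 absz) : a%:Z * x = 1.
    apply: (@intr_inj R); have := congr1 s1 one_eq.
    by rewrite y0 mulr0 addr0 rmorph1 !rmorphM rmorph_nat rmorph_int => /esym.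
  by rewrite abszM => /eqP; rewrite muln_eq1 => /andP[/eqP].
by move: b_lt_a g_dvd_a; rewrite a1 ltnS leqn0 dvdn1 => /eqP-> /eqP->.
Qed.

Lemma canonical_generator_sqrt5 (R : realType) (K : fieldExtType rat) (s : K)
    (f : {rmorphism K -> R}) :
  f (0%:R + 1%:R * delta 5 s) = (1 - f s) / 2%:R.
Proof. by rewrite rmorphD rmorphM !rmorph_nat delta_embedding /=; ring. Qed.

Lemma stable_twistable_sqrt5 (R : realType) (K : fieldExtType rat) (s : K)
    (s1 s2 : {rmorphism K -> R}) :
  s1 s = Num.sqrt 5%:R -> s2 s = - Num.sqrt 5%:R ->
  stable_twistable s1 s2 (delta 5 s) 1 0 1.
Proof.
(* With [t] the square root of 5, unit length of the first column and orthogonality read [p + q = 1]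
   and [p (1 - t) + q (1 + t) = 0]. They force [p = (5 + t) / 10] and [q = (5 - t) / 10]; the second
   column then also has unit length. *)
move=> s1s s2s; exists ((5%:R + s) / 10%:R).
set alpha := _ / _.
have t_gt0 : 0 < Num.sqrt 5%:R :> R by rewrite sqrtr_gt0 ltr0n.
have t2 : Num.sqrt 5%:R ^+ 2 = 5%:R :> R by rewrite sqr_sqrtr ?ler0n.
have s1alpha : s1 alpha = (5%:R + Num.sqrt 5%:R) / 10%:R.
  by rewrite rmorphM fmorphV rmorphD !rmorph_nat s1s.
have s2alpha : s2 alpha = (5%:R - Num.sqrt 5%:R) / 10%:R.
  by rewrite rmorphM fmorphV rmorphD !rmorph_nat s2s.
have p_gt0 : 0 < s1 alpha by rewrite s1alpha divr_gt0 ?ltr0n //; lra.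
have q_gt0 : 0 < s2 alpha by rewrite s2alpha divr_gt0 ?ltr0n //; nra.
split=> //=; apply: orthonormal_reduced_stable.
set M : 'M[R]_2 := twist _ _ _ *m _.
have [M00 M10 M01 M11] := twisted_basis (erefl M).
have p2 := sqr_sqrtr (ltW p_gt0); have q2 := sqr_sqrtr (ltW q_gt0).
have s1d := canonical_generator_sqrt5 s s1; rewrite s1s in s1d.
have s2d := canonical_generator_sqrt5 s s2; rewrite s2s opprK in s2d.
rewrite s1d in M01; rewrite s2d in M11; rewrite !rmorph_nat in M00 M10.
rewrite {2}s1alpha in p2; rewrite {2}s2alpha in q2.
move: t2 p2 q2 M00 M10 M01 M11.
move: (Num.sqrt (s1 alpha)) (Num.sqrt (s2 alpha)) (Num.sqrt 5%:R).
move=> P Q t t2 p2 q2 M00 M10 M01 M11.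
clearbody M; have sum2 (F : 'I_2 -> R) : \sum_i F i = F 0 + F 1.
  by rewrite big_ord_recl big_ord1; congr (_ + F _); apply/val_inj.
have ord2 (i : 'I_2) : i = 0 \/ i = 1.
  by case: i => [[|[|//]] ?]; [left | right]; apply/val_inj.
have off_diag : P * 1%:R * (P * ((1 - t) / 2%:R)) +
    Q * 1%:R * (Q * ((1 + t) / 2%:R)) = 0.
  transitivity (P ^+ 2 * ((1 - t) / 2%:R) + Q ^+ 2 * ((1 + t) / 2%:R)); first ring.
  rewrite p2 q2; transitivity ((5%:R - t ^+ 2) / 10%:R); first by field.
  by rewrite t2 subrr mul0r.
apply/matrixP=> i j; rewrite [LHS]mxE sum2 !mxE.
case: (ord2 i) => ->; case: (ord2 j) => ->; rewrite ?M00 ?M01 ?M10 ?M11 //=.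
- transitivity (P ^+ 2 + Q ^+ 2); first ring.
  by rewrite p2 q2; field.
- by rewrite mulrC [Q * _ * _]mulrC.
- transitivity (P ^+ 2 * ((1 - t) / 2%:R) ^+ 2 + Q ^+ 2 * ((1 + t) / 2%:R) ^+ 2).
    ring.
  rewrite p2 q2; transitivity ((5%:R + 3%:R * t ^+ 2) / 20%:R); first by field.
  by rewrite t2; field.
Qed.

(** * Assembly of the three assertions, with [t] for the square root of [D] *)

Theorem theorem1p7 (R : realType) (D : nat) (D_gt1 : (1 < D)%N)
    (D_sqfree : squarefree D)
    (K : fieldExtType rat) (s : K) (K_eq : generated_by_sqrt D s)
    (sigma1 sigma2 : {rmorphism K -> R})
    (sigma1_s : sigma1 s = Num.sqrt D%:R)
    (sigma2_s : sigma2 s = - Num.sqrt D%:R) :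
  [/\ finite_set
        [set similarity_class [set sigmaK sigma1 sigma2 x | x in I] | I in
          [set I : set K | nonzero_ideal I /\
             has_stable_twistable_basis sigma1 sigma2 (delta D s) I]],
      forall (I : set K) (a b g : nat),
        nonzero_ideal I ->
        canonical_basis sigma1 sigma2 (delta D s) I a b g ->
        stable_twistable sigma1 sigma2 (delta D s) a b g ->
        (b%:R : R) <
          if (D %% 4 == 1)%N
          then g%:R / 2%:R * (2%:R / Num.sqrt 3%:R * Num.sqrt D%:R - 1)
          else 2%:R / Num.sqrt 3%:R * g%:R * Num.sqrt D%:R &
      has_stable_twistable_basis sigma1 sigma2 (delta D s)
        (@ring_of_integers K) <->
      exists r : K, generated_by_sqrt 5 r].
Proof.
have D_gt0 : (0 < D)%N by apply: ltnW.
have DR_gt0 : 0 < D%:R :> R by rewrite ltr0n.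
set t : R := Num.sqrt D%:R in sigma1_s sigma2_s *.
have t_gt0 : 0 < t by rewrite sqrtr_gt0.
have t2 : t ^+ 2 = D%:R by rewrite sqr_sqrtr // ltW.
have embed1 := delta_embedding D s sigma1.
have embed2 := delta_embedding D s sigma2.
rewrite sigma1_s in embed1; rewrite sigma2_s in embed2.
(* The difference of the conjugates of delta is the square root of the field discriminant, [D] or
   [4 D]. *)
have gap : sigma2 (delta D s) - sigma1 (delta D s) =
    (if (D %% 4 == 1)%N then 1 else 2) * t.
  by rewrite embed1 embed2; case: ifP => _; field.
have r3_gt0 : 0 < Num.sqrt 3%:R :> R by rewrite sqrtr_gt0 ltr0n.
have r3 : Num.sqrt 3%:R ^+ 2 = 3%:R :> R by rewrite sqr_sqrtr ?ler0n.
split.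
- exact: finite_stable_twistable_classes.
- move=> I a b g _ can twistable; have [a_gt0 g_gt0] := canonical_basis_gt0 can.
  have a_le : Num.sqrt 3%:R * a%:R <=
      g%:R * ((if (D %% 4 == 1)%N then 1 else 2) * t).
    rewrite -gap -(ler_pXn2r (n := 2)) ?nnegrE ?exprMn ?r3 //; last 2 first.
    + by rewrite mulr_ge0 ?ler0n // ltW.
    + by rewrite gap !mulr_ge0 ?ler0n ?ltW //; case: ifP.
    by rewrite -exprMn; apply: stable_twistable_bound twistable.
  case: can => _ b_lt_a /dvdnP[a' aE] /dvdnP[b' bE] _.
  (* Both [a] and [b] are multiples of [g], so [b < a] leaves a gap of at least [g]. This yields the
     term [- g / 2] when [D] is 1 modulo 4, and strictness in both cases. *)
  have b_add_g : b%:R + g%:R <= a%:R :> R.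
    rewrite -natrD ler_nat; move: b_lt_a; rewrite aE bE ltn_pmul2r // => b'_lt_a'.
    by rewrite -mulSnr leq_pmul2r.
  have g_gt0R : 0 < g%:R :> R by rewrite ltr0n.
  case: ifP a_le => _ a_le.
    have : a%:R <= g%:R * t / Num.sqrt 3%:R by rewrite ler_pdivlMr //; lra.
    have -> : g%:R / 2%:R * (2%:R / Num.sqrt 3%:R * t - 1) =
      g%:R * t / Num.sqrt 3%:R - g%:R / 2%:R by field; rewrite gt_eqF.
    by move=> ?; lra.
  have : a%:R <= g%:R * (2 * t) / Num.sqrt 3%:R by rewrite ler_pdivlMr //; lra.
  have -> : 2%:R / Num.sqrt 3%:R * g%:R * t = g%:R * (2 * t) / Num.sqrt 3%:R.
    by field; rewrite gt_eqF.
  by move=> ?; lra.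
- split=> [[a [b [g [can twistable]]]]|[r [r5 _]]]; last first.
    have D5 := quadratic_sqrt5 D_sqfree K_eq sigma1_s sigma2_s D_gt0 r5.
    move: K_eq sigma1_s sigma2_s; rewrite /t D5 => gen5 s1s s2s.
    exists 1%N, 0%N, 1%N; split; last exact: stable_twistable_sqrt5.
    split=> //.
      rewrite (integers_sqrt5 gen5 s1s s2s); apply/seteqP.
      by split=> z [x [y ->]] /=; exists x, y; ring.
    (* The norm of delta is [(1 - 5) / 4 = -1]. *)
    exists (- 1); last by rewrite dvd1z.
    rewrite /field_norm !canonical_generator_sqrt5 s1s s2s rmorphN rmorph1.
    move: t2; rewrite /t D5 => t2.
    transitivity ((1 - Num.sqrt 5%:R ^+ 2) / 4%:R : R); first by field.
    by rewrite t2; field.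
  have d_neq : sigma1 (delta D s) != sigma2 (delta D s).
    by rewrite eq_sym -subr_eq0 gap mulf_neq0 ?(gt_eqF t_gt0) //; case: ifP => _;
      rewrite ?oner_eq0 ?pnatr_eq0.
  have [a1 b0 g1] := ring_of_integers_canonical d_neq can; subst a b g.
  have [p [q /= [p_gt0 q_gt0 gram1 _ gram3]]] := stable_twistable_gram twistable.
  have D5 : D = 5%N.
    move: gram1 gram3.
    have : 0%:R + 1%:R * sigma2 (delta D s) -
        (0%:R + 1%:R * sigma1 (delta D s)) =
        (if (D %% 4 == 1)%N then 1 else 2) * t by rewrite -gap; ring.
    have : 0%:R + 1%:R * sigma1 (delta D s) +
        (0%:R + 1%:R * sigma2 (delta D s)) =
        (if (D %% 4 == 1)%N then 1 else 0) :> R.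
      by rewrite embed1 embed2; case: ifP => _; field.
    move: (_ + _ * sigma1 _) (_ + _ * sigma2 _) => x y xy_sum xy_gap.
    rewrite expr1n !mul1r mulr1 => gram1 gram3.
    have := stable_form_bound p_gt0 q_gt0 _ gram1 gram3.
    rewrite xy_sum xy_gap {xy_sum xy_gap}.
    (* If [D] is 1 modulo 4, delta has trace 1 and the bound reads [D <= 4 + 2^2], leaving only 5.
       Otherwise the trace is 0 and [4 D <= 4 + 1^2] contradicts [D > 1]. *)
    case: ifP => [/eqP Dmod | _] bound.
      have : D%:R <= 8%:R :> R by have := bound ler01; lra.
      by rewrite ler_nat; clear - D_gt1 Dmod; lia.
    have : (4 * D)%:R <= 5%:R :> R by have := bound (lexx 0); rewrite natrM; lra.
    by rewrite ler_nat; clear - D_gt1; lia.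
  by exists s; rewrite -D5.
Qed.
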